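(* Let $r_1$ and $r_2$ be two partial routes, both ending at the same node $i\in\mathcal{N}$, with labels $E_{r_d}=(C_{r_d},[V^l_{r_d}]_{l\in\mathcal{N}_c},T_{r_d},L_{r_d},A^{\mathcal{H}}_{r_d},A^{\mathcal{L}}_{r_d},X_{r_d})$, $d=1,2$. Then $r_1$ dominates $r_2$ if the following relations hold: $$C_{r_1}\le C_{r_2},\qquad T_{r_1}\le T_{r_2},\qquad L_{r_1}\le L_{r_2},\qquad V^l_{r_1}\le V^l_{r_2}\ \ \forall l\in\mathcal{N}_c,$$ $$\min\{X_{r_1},\ Q-L_{r_1}-(k-A^{\mathcal{H}}_{r_1}-1)\}\ \ge\ Q-L_{r_2}.$$
   Context: Setting. $\mathcal{N}=\{0,1,\ldots,n,n+1\}$ is the node set, $\mathcal{N}_c=\{1,\ldots,n\}$ the customers, and $0$, $n+1$ represent the depot at the start and end of a route. $\mathcal{A}$ is the arc set, a subset of the pairs $(i,j)$ with $i\ne j$. Each arc has a travel time $t_{ij}$ and a (possibly negative) modified cost $\bar c_{ij}$ (a real number). Each customer $i$ has an integer demand $q_i$ (number of items picked up) and a time window $[\underline{w}_i,\overline{w}_i]$; $q_{n+1}=0$. $\mathcal{N}_c$ is partitioned into $\mathcal{L}$ (customers with fragile items) and $\mathcal{H}$ (customers with non-fragile items). The vehicle has $m$ stacks of height $k$ and capacity $Q=mk$. The function $F$ is $F(x)=x\bmod k$ if $x\bmod k\ne 0$ and $F(x)=k$ otherwise. Labels. A partial route $r=(0,\ldots,i)$ is encoded by a label $E_r=(C_r,[V_r^l]_{l\in\mathcal{N}_c},T_r,L_r,A^{\mathcal{H}}_r,A^{\mathcal{L}}_r,X_r)$,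 whose components represent: reduced cost, unreachability indicators of customers, earliest service start time, total load, number of non-fragile items collected, number of fragile items collected, and maximum number of non-fragile items that can still be collected. The label of the partial route $(0)$ is $(0,[0]_{l\in\mathcal{N}_c},0,0,0,0,Q)$. The label of the extension $r'$ of $r=(0,\ldots,i)$, $i\neq n+1$, along an arc $(i,j)\in\mathcal{A}$ (with $j\in\mathcal{N}_c\cup\{n+1\}$) is given by: - $C_{r'}=C_r+\bar c_{ij}$; - $T_{r'}=\max\{T_r+t_{ij},\underline{w}_j\}$ if $j\ne n+1$, and $T_{r'}=T_r+t_{ij}$ otherwise; - $L_{r'}=L_r+q_j$; - $A^{\mathcal{H}}_{r'}=A^{\mathcal{H}}_r+q_j$ if $j\in\mathcal{H}$, and $A^{\mathcal{H}}_r$ otherwise; - $A^{\mathcal{L}}_{r'}=A^{\mathcal{L}}_r+q_j$ if $j\in\mathcal{L}$, and $A^{\mathcal{L}}_r$ otherwise; - for all $l\in\mathcal{N}_c$: $V^l_{r'}=V^l_r+1$ if $j=l$; $V^l_{r'}=V^l_r$ if $j=n+1$; $V^l_{r'}=\max\{V^l_r,\mathcal{Z}_{jl}(T_{r'},L_{r'})\}$ otherwise, where $\mathcal{Z}_{jl}(T,L)=1$ if $T+t_{jl}>\overline{w}_l$ or $L+q_l>Q$, and $0$ otherwise; - $X_{r'}=\min\{X_r,Q-L_{r'}\}$ if $j\in\mathcal{L}$ and $A^{\mathcal{H}}_{r'}+F(A^{\mathcal{L}}_{r'})\ge k$; $X_{r'}=\min\{X_r,U_{r'}\}$ if $j\in\mathcal{L}$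 and $A^{\mathcal{H}}_{r'}+F(A^{\mathcal{L}}_{r'})<k$; $X_{r'}=X_r-q_j$ otherwise; here $U_{r'}=Q-(L_{r'}-(L_{r'}\bmod k)+k)$. Feasibility. The label $E_{r'}$ obtained at node $j$ is feasible if $j=n+1$, or if $V^l_{r'}\le 1$ for all $l\in\mathcal{N}_c$, $T_{r'}\le\overline{w}_j$, $L_{r'}\le Q$ and $X_{r'}\ge 0$. Infeasible labels are discarded (not extended). An extension $e$ (a sequence of one or more consecutive arcs starting at the end node of the partial route) is feasible for $r$ if all labels obtained along it starting from $E_r$ are feasible; $r\oplus e$ denotes the partial route obtained by extending $r$ along $e$. Dominance. $r_1$ dominates $r_2$ (equivalently, $E_{r_1}$ dominates $E_{r_2}$) if any feasible (single- or multiple-arc) extension $e$ of $r_2$ is also feasible for $r_1$, and for any such extension $e$ the inequality $C_{r_1\oplus e}\le C_{r_2\oplus e}$ holds. *)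

(* Defs.v *)
From HB Require Import structures.
From mathcomp Require Import all_boot all_order all_algebra.
From mathcomp Require Import reals.

Set Implicit Arguments.
Unset Strict Implicit.
Unset Printing Implicit Defensive.

Import Order.TTheory GRing.Theory Num.Theory.

Local Open Scope ring_scope.

(* The nodes are 0, ..., n+1; the depot is ord0 at the start of a route and
   ord_max at its end. *)
Definition node (n : nat) : finType := 'I_n.+2.

Definition customers (n : nat) : {set node n} :=
  [set i : node n | (i != ord0) && (i != ord_max)].

Definition customer (n : nat) : Type := {l : node n | l \in customers n}.

(* Travel times are total on pairs of nodes, because the unreachability test
   reads t j l without requiring (j, l) to be an arc.  The values of demand
   and of the time windows at ord0 and the windows at ord_max are never used. *)
Record instance (R : realType) (n : nat) := Instance {
  arcs : {set node n * node n};
  arcs_neq : forall a : node n * node n, a \in arcs -> a.1 != a.2;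
  travel_time : node n -> node n -> R;
  mod_cost : node n -> node n -> R;
  demand : node n -> nat;
  demand_end : demand ord_max = 0%N;
  window_lo : node n -> R;
  window_hi : node n -> R;
  fragile : {set node n};
  nonfragile : {set node n};
  items_cover : fragile :|: nonfragile = customers n;
  items_disjoint : [disjoint fragile & nonfragile];
  stacks : nat;
  stacks_gt0 : (0 < stacks)%N;
  height : nat;
  height_gt0 : (0 < height)%N
}.

Definition capacity (R : realType) (n : nat) (P : instance R n) : nat :=
  (stacks P * height P)%N.

Definition top_level (k x : nat) : nat :=
  if (x %% k != 0)%N then (x %% k)%N else k.

(* X is an integer rather than a natural number: it becomes negative on
   infeasible labels. *)
Record label (R : realType) (n : nat) := Label {
  lC : R;
  lV : customer n -> nat;
  lT : R;
  lL : nat;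
  lAH : nat;
  lAL : nat;
  lX : int
}.

Section Model.
Variables (R : realType) (n : nat) (P : instance R n).

Let k := height P.
Let Q := capacity P.

Definition label0 : label R n :=
  {| lC := 0; lV := fun=> 0%N; lT := 0; lL := 0%N; lAH := 0%N; lAL := 0%N;
     lX := Q%:Z |}.

Definition unreachable (j : node n) (l : customer n) (T : R) (L : nat) : nat :=
  if (T + travel_time P j (val l) > window_hi P (val l))
     || (L + demand P (val l) > Q)%N
  then 1%N else 0%N.

Definition extend (i : node n) (E : label R n) (j : node n) : label R n :=
  let T := if j != ord_max
           then Num.max (lT E + travel_time P i j) (window_lo P j)
           else lT E + travel_time P i j in
  let L := (lL E + demand P j)%N in
  let AH := if j \in nonfragile P then (lAH E + demand P j)%N else lAH E in
  let AL := if j \in fragile P then (lAL E + demand P j)%N else lAL E in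
  let U : int := Q%:Z - (L%:Z - (L %% k)%N%:Z + k%:Z) in
  {| lC := lC E + mod_cost P i j;
     lV := fun l => if j == val l then (lV E l).+1
                    else if j == ord_max then lV E l
                    else maxn (lV E l) (unreachable j l T L);
     lT := T;
     lL := L;
     lAH := AH;
     lAL := AL;
     lX := if j \in fragile P then
             if (k <= AH + top_level k AL)%N
             then Num.min (lX E) (Q%:Z - L%:Z)
             else Num.min (lX E) U
           else lX E - (demand P j)%:Z |}.

Fixpoint label_from (i : node n) (E : label R n) (s : seq (node n))
    : label R n :=
  if s is j :: s' then label_from j (extend i E j) s' else E.

(* A route (0, v_1, ..., v_p) is represented by the sequence v_1, ..., v_p of
   nodes visited after the starting depot. *)
Definition label_of (r : seq (node n)) : label R n :=
  label_from ord0 label0 r.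

Definition end_node (r : seq (node n)) : node n := last ord0 r.

Definition step : rel (node n) :=
  [rel i j | [&& (i, j) \in arcs P, i != ord_max & j != ord0]].

Definition partial_route (r : seq (node n)) : Prop := path step ord0 r.

Definition label_feasible (j : node n) (E : label R n) : Prop :=
  j = ord_max \/
  [/\ forall l : customer n, (lV E l <= 1)%N,
      lT E <= window_hi P j,
      (lL E <= Q)%N
    & 0 <= lX E].

(* An extension is given by the successive heads of its arcs, so that the
   route r extended along e is r ++ e. *)
Definition feasible_extension (r e : seq (node n)) : Prop :=
  [/\ e != [::],
      path step (end_node r) e
    & forall p : nat, (0 < p <= size e)%N ->
        label_feasible (end_node (r ++ take p e)) (label_of (r ++ take p e))].

Definition dominates (r1 r2 : seq (node n)) : Prop :=
  forall e : seq (node n), feasible_extension r2 e ->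
    feasible_extension r1 e /\
    lC (label_of (r1 ++ e)) <= lC (label_of (r2 ++ e)).

End Model.

(* Main.v *)
Require Import Defs.
From mathcomp Require Import all_boot all_order all_algebra.
From mathcomp Require Import reals.
From mathcomp Require Import zify.

Set Implicit Arguments.
Unset Strict Implicit.
Unset Printing Implicit Defensive.

Import Order.TTheory GRing.Theory Num.Theory.

Local Open Scope ring_scope.

(** The hypotheses of the dominance test form a relation between labels that
    every single-arc extension preserves ([extend_dominance]), and that
    transfers feasibility from the dominated label to the dominating one
    ([label_feasible_dominance]); induction along the extension does the rest.

    For cost, time, load and unreachability this holds because each update is
    monotone.  For the resource [X = lX], the maintained property compares [X1]
    with the load of the second route: [Q - L2 <= X1], that is, the first route
    can still collect as many non-fragile items as the second has places left.
    Since [L2 <= Q] on a feasible label, this gives [0 <= X1].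

    A non-fragile customer lowers both sides of [Q - L2 <= X1] by its demand.  A
    fragile customer caps [X1] either by [Q - L1], which is at least [Q - L2], or by
    [Q - (L1 - L1 mod k + k)], the room left once the current level of the
    stacks is closed.  The second cap applies only when the non-fragile items
    and the [F(AL1) >= 1] fragile items of the top level fit together in one
    level; then [L1 mod k = AH1 + F(AL1) >= AH1 + 1], so that closing the level
    wastes at most [k - AH1 - 1] places.  The condition
    [L1 + (k - AH1 - 1) <= L2] says that the lead of the first route in load
    covers this waste, and it survives every extension, as [L1] and [L2] grow
    equally and [AH1] never decreases. *)

Section Dominance.
Variables (R : realType) (n : nat) (P : instance R n).
Implicit Types (i j : node n) (E : label R n) (r e : seq (node n)).

Let k := height P.
Let Q := capacity P.

Lemma top_level_gt0 x : (0 < top_level k x)%N.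
Proof. by rewrite /top_level; case: ifP; rewrite ?height_gt0 // lt0n. Qed.

(** If the sum stays below [k], then [top_level k x] is not the exceptional
    value [k], so it is the residue of [x]. *)
Lemma modn_top_level a x :
  (a + top_level k x < k)%N -> ((a + x) %% k = a + top_level k x)%N.
Proof.
rewrite /top_level; case: ifP => _ lt_k; last by move: lt_k; lia.
by rewrite -modnDmr modn_small.
Qed.

(** The customers are split into fragile and non-fragile ones and the end depot
    has zero demand, so the two item counters always add up to the load.  The
    start depot has to be excluded: its demand is arbitrary and goes into
    neither counter. *)
Definition balanced E : Prop := lL E = (lAH E + lAL E)%N.

Lemma extend_balanced i E j :
  j != ord0 -> balanced E -> balanced (extend P i E j).
Proof.
rewrite /balanced /= => j_neq0 ->.
have : (j \in fragile P :|: nonfragile P) = (j \in customers n).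
  by rewrite items_cover.
rewrite !inE j_neq0 /=.
case fj: (j \in fragile P).
  by rewrite (disjointFr (items_disjoint P) fj) addnA.
by case: ifP => //= _; [rewrite addnAC |
    move/esym/negbFE/eqP ->; rewrite demand_end addn0].
Qed.

Lemma label_from_balanced i E r :
  path (step P) i r -> balanced E -> balanced (label_from P i E r).
Proof.
elim: r i E => //= j r IHr i E /andP[/and3P[_ _ j_neq0] /IHr balr] balE.
exact/balr/extend_balanced.
Qed.

Lemma unreachable_mono j l (T1 T2 : R) L1 L2 :
  T1 <= T2 -> (L1 <= L2)%N ->
  (unreachable P j l T1 L1 <= unreachable P j l T2 L2)%N.
Proof.
move=> leT leL; rewrite /unreachable.
case: ifP => // /orP late1; suff -> : (T2 + travel_time P j (val l) >
    window_hi P (val l)) || (L2 + demand P (val l) > capacity P)%N by [].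
apply/orP; case: late1 => [lt1|lt1]; [left|right].
  by apply: (lt_le_trans lt1); rewrite lerD2r.
by apply: (leq_trans lt1); rewrite leq_add2r.
Qed.

(** The relation of the dominance test.  The last two fields are the two
    arguments of the minimum in the test, the second one rewritten over the
    natural numbers. *)
Record label_dominance E1 E2 : Prop := LabelDominance {
  dom_cost : lC E1 <= lC E2;
  dom_time : lT E1 <= lT E2;
  dom_load : (lL E1 <= lL E2)%N;
  dom_visits : forall l, (lV E1 l <= lV E2 l)%N;
  dom_balanced : balanced E1;
  dom_room : Q%:Z - (lL E2)%:Z <= lX E1;
  dom_waste : (lL E1 + k <= lL E2 + (lAH E1).+1)%N
}.

(** With [a] non-fragile and [x] fragile items collected by the first route,
    closing its current level wastes [k - (a + x) mod k] places; the lead of the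
    first route in load is spent here. *)
Lemma dominance_closed_level a x L2 :
  (a + top_level k x < k)%N -> (a + x + k <= L2 + a.+1)%N ->
  (a + x - (a + x) %% k + k <= L2)%N.
Proof.
move=> lt_k waste; have := modn_top_level lt_k; have := top_level_gt0 x.
by have := leq_mod (a + x) k; lia.
Qed.

(** A non-fragile demand is subtracted on both sides.  At a fragile customer each
    cap on [lX] is at least the capacity left to the second route: the lead in
    load suffices for the cap [Q - L1], and [dominance_closed_level] handles the
    other one. *)
Lemma extend_room i E1 E2 j : j != ord0 -> label_dominance E1 E2 ->
  Q%:Z - (lL (extend P i E2 j))%:Z <= lX (extend P i E1 j).
Proof.
move=> j_neq0 [_ _ leL _ bal1 room waste].
have := extend_balanced i j_neq0 bal1; rewrite /balanced /=.
case fj: (j \in fragile P); last by move=> _; move: room; lia.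
rewrite (disjointFr (items_disjoint P) fj) => bal1'.
case: ifP => [_|/negbT]; first by rewrite le_min; move: room leL; lia.
rewrite -ltnNge => open_level.
have leL2 : (lL E1 + demand P j + k <= lL E2 + demand P j + (lAH E1).+1)%N.
  by move: waste; lia.
rewrite bal1' in leL2 *.
have := dominance_closed_level open_level leL2.
have := leq_mod (lAH E1 + (lAL E1 + demand P j)) k.
by rewrite le_min -/k -/Q; move: room; lia.
Qed.

Lemma extend_dominance i E1 E2 j : j != ord0 ->
  label_dominance E1 E2 ->
  label_dominance (extend P i E1 j) (extend P i E2 j).
Proof.
move=> j_neq0 dom; have room' := extend_room i j_neq0 dom.
case: dom => leC leT leL leV bal1 _ waste.
have leT' : lT (extend P i E1 j) <= lT (extend P i E2 j).
  rewrite /=; case: ifP => _; last by rewrite lerD2r.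
  by rewrite ge_max !le_max lexx lerD2r leT orbT.
have leL' : (lL (extend P i E1 j) <= lL (extend P i E2 j))%N.
  by rewrite /= leq_add2r.
split=> //.
- by rewrite /= lerD2r.
- move=> l /=; case: ifP => _; first by rewrite ltnS.
  move: leT' => /=; case: (j == ord_max) => //= leT'.
  by rewrite geq_max !leq_max leV unreachable_mono ?orbT.
- exact: extend_balanced.
- by move=> /=; case: ifP => _; move: waste; lia.
Qed.

Lemma label_from_dominance i E1 E2 e : path (step P) i e ->
  label_dominance E1 E2 ->
  label_dominance (label_from P i E1 e) (label_from P i E2 e).
Proof.
elim: e i E1 E2 => //= j e IHe i E1 E2 /andP[/and3P[_ _ j_neq0] pe] dom.
exact/IHe/extend_dominance.
Qed.

Lemma label_feasible_dominance j E1 E2 :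
  label_dominance E1 E2 -> label_feasible P j E2 -> label_feasible P j E1.
Proof.
case=> _ leT leL leV _ room _ [->|[V2 T2 L2 _]]; first by left.
right; split.
- by move=> l; apply: leq_trans (V2 l).
- exact: le_trans T2.
- exact: leq_trans L2.
- by apply: le_trans room; rewrite subr_ge0 lez_nat.
Qed.

Lemma label_of_cat r e :
  label_of P (r ++ e) = label_from P (end_node r) (label_of P r) e.
Proof.
rewrite /label_of /end_node.
by elim: r (ord0 : node n) (label0 P) => /=.
Qed.

Lemma label_dominance_dominates r1 r2 : end_node r1 = end_node r2 ->
  label_dominance (label_of P r1) (label_of P r2) -> dominates P r1 r2.
Proof.
move=> end12 dom e [e_neq0 pe feas].
have dom_cat e' : path (step P) (end_node r2) e' ->
    label_dominance (label_of P (r1 ++ e')) (label_of P (r2 ++ e')).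
  by move=> pe'; rewrite !label_of_cat end12; apply: label_from_dominance.
split; last exact: dom_cost (dom_cat e pe).
split=> //; first by rewrite end12.
move=> p /feas; have -> : end_node (r1 ++ take p e) = end_node (r2 ++ take p e).
  by rewrite /end_node !last_cat -/(end_node r1) end12.
by apply: label_feasible_dominance; apply/dom_cat/take_path.
Qed.

End Dominance.

Theorem proposition4p1 (R : realType) (n : nat) (P : instance R n)
    (i : node n) (r1 r2 : seq (node n))
    (hr1 : partial_route P r1) (hr2 : partial_route P r2)
    (hi1 : end_node r1 = i) (hi2 : end_node r2 = i)
    (hC : lC (label_of P r1) <= lC (label_of P r2))
    (hT : lT (label_of P r1) <= lT (label_of P r2))
    (hL : (lL (label_of P r1) <= lL (label_of P r2))%N)
    (hV : forall l : customer n,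
        (lV (label_of P r1) l <= lV (label_of P r2) l)%N)
    (hX : Num.min (lX (label_of P r1))
            ((capacity P)%:Z - (lL (label_of P r1))%:Z
             - ((height P)%:Z - (lAH (label_of P r1))%:Z - 1))
          >= (capacity P)%:Z - (lL (label_of P r2))%:Z) :
  dominates P r1 r2.
Proof.
move: hX; rewrite le_min => /andP[room waste].
apply: label_dominance_dominates; first by rewrite hi1 hi2.
split=> //; first exact: label_from_balanced.
by move: waste; lia.
Qed.
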